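(* Let $C$ be a $d$-dimensional copula and let $\boldsymbol{\kappa}(C) = (\kappa_I : I \in \mathcal{E}(\mathcal{D}))$ be its even concordance signature. Then there exists a unique extremal mixture copula $C^* = \sum_{k=1}^{2^{d-1}} w_k C^{(k)}$ such that $\boldsymbol{\kappa}(C) = \boldsymbol{\kappa}(C^* )$. The weights $w_k$, which are non-negative and add up to $1$, are the unique solution to the system of $2^{d-1}$ linear equations given by $$\boldsymbol{\kappa}(C) = \sum_{k=1}^{2^{d-1}} w_k \boldsymbol{a}_k,$$ where $\boldsymbol{a}_k = (a_{I,k} : I \in \mathcal{E}(\mathcal{D}))$ for $k \in \{1,\ldots,2^{d-1}\}$.
   Context: Let $d \ge 2$ and $\mathcal{D} = \{1,\ldots,d\}$. A $d$-dimensional copula is a distribution function on $[0,1]^d$ with standard uniform margins. $\mathcal{E}(\mathcal{D})$ is the collection of all subsets of $\mathcal{D}$ of even cardinality, including $\emptyset$ (it has $2^{d-1}$ elements). Concordance probabilities: let $C$ be a copula, $\boldsymbol{U}\sim C$, and $\boldsymbol{U}^*$ an independent copy of $\boldsymbol{U}$. For $I\subseteq\mathcal{D}$, $\boldsymbol{U}_I$ is the subvector with indices in $I$ and $C_I$ its distribution function. For $|I|\ge 2$ define $\kappa_I = \kappa(C_I) = \mathbb{P}(\{\boldsymbol{U}_I \le \boldsymbol{U}_I^*\}\cup\{\boldsymbol{U}_I^*\le \boldsymbol{U}_I\})$ (componentwise inequalities); set $\kappa_I = 1$ when $|I|\le 1$. The even concordance signature of $C$ is $\boldsymbol{\kappa}(C)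 = (\kappa(C_I): I\in\mathcal{E}(\mathcal{D}))$. Extremal copulas: for $k\in\{1,\ldots,2^{d-1}\}$ let $\boldsymbol{s}_k=(s_{k,1},\ldots,s_{k,d})\in\{0,1\}^d$ be the vector of digits of $k-1$ written as a $d$-digit binary number, let $J_k=\{j\in\mathcal{D}: s_{k,j}=0\}$ and $J_k^\complement = \mathcal{D}\setminus J_k$. The $k$th extremal copula is $C^{(k)}(\boldsymbol{u}) = (\min_{j\in J_k}u_j + \min_{j\in J_k^\complement}u_j - 1)^+$, with $\min_{j\in\emptyset}u_j = 1$ and $x^+=\max(x,0)$. An extremal mixture copula is a copula of the form $\sum_{k=1}^{2^{d-1}} w_k C^{(k)}$ with $w_k\ge 0$ and $\sum_k w_k = 1$. For $I\subseteq\mathcal{D}$, $a_{I,k} = 1$ if $I\subseteq J_k$ or $I\subseteq J_k^\complement$, and $a_{I,k}=0$ otherwise. *)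

(* Defs.v *)
From HB Require Import structures.
From mathcomp Require Export all_boot all_order all_algebra.
From mathcomp Require Export all_classical all_reals all_analysis.
From mathcomp Require Export measurable_realfun.
Export Order.TTheory GRing.Theory Num.Theory.
Export numFieldNormedType.Exports.

Set Implicit Arguments.
Unset Strict Implicit.
Unset Printing Implicit Defensive.

Local Open Scope classical_set_scope.
Local Open Scope ring_scope.

(* Copulas are functions on [0,1]^d itself, so that [=] between two of them
   does not depend on a choice of values outside the cube. *)
Definition cube (R : realType) (d : nat) := 'I_d -> {i01 R}.

(* [C] is the joint distribution function on [0,1]^d of a random vector with
   law [P]; by the margins, such a [P] gives mass 1 to [0,1]^d. *)
Definition law_of (R : realType) (d : nat) (C : cube R d -> R)
    (P : probability (d.-tuple R) R) : Prop :=
  (forall u : cube R d,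
     P [set x | forall j, tnth x j <= (u j)%:num] = (C u)%:E) /\
  (forall (j : 'I_d) (A : set R), measurable A ->
     pushforward P (fun x => tnth x j) A = uniform_prob (@ltr01 R) A).

Definition is_copula (R : realType) (d : nat) (C : cube R d -> R) : Prop :=
  exists P : probability (d.-tuple R) R, law_of C P.

Definition concordant (R : realType) (d : nat) (I : {set 'I_d}) :
    set (d.-tuple R * d.-tuple R) :=
  [set p | forall j, j \in I -> tnth p.1 j <= tnth p.2 j] `|`
  [set p | forall j, j \in I -> tnth p.2 j <= tnth p.1 j].

(* [P \x P] is the law of [(U, U')], with [U'] an independent copy of
   [U ~ C]. The law [P] is determined by [C] ([law_of_unique]), and any other
   independent pair gives the same value ([kappaE]); for [C] not a copula the
   value is arbitrary when [1 < #|I|]. *)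
Definition kappa (R : realType) (d : nat) (C : cube R d -> R)
    (I : {set 'I_d}) : R :=
  if (#|I| <= 1)%N then 1
  else get [set r : R | exists2 P : probability (d.-tuple R) R,
              law_of C P & (P \x P)%E (concordant I) = r%:E].

Definition even_set (d : nat) := {I : {set 'I_d} | ~~ odd #|I|}.

(* [R^o] gives vectors of this type their scaling [*:]. *)
Definition even_signature (R : realType) (d : nat) (C : cube R d -> R) :
    {ffun even_set d -> R^o} :=
  [ffun I => kappa C (val I)].

(* Indices [k] and [j] start at 0, so [k] here is the informal k - 1. *)
Definition Jset (d : nat) (k : 'I_(2 ^ d.-1)) : {set 'I_d} :=
  [set j : 'I_d | ~~ odd (k %/ 2 ^ (d.-1 - j))]%SET.

(* The unit 1 of the minimum is harmless because [u j <= 1]; it is the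
   convention for the empty set. *)
Definition min_over (R : realType) (d : nat) (J : {set 'I_d})
    (u : cube R d) : R :=
  \big[Num.min/1]_(j in J) (u j)%:num.

Definition extremal_copula (R : realType) (d : nat) (k : 'I_(2 ^ d.-1))
    (u : cube R d) : R :=
  Num.max (min_over (Jset k) u + min_over (~: Jset k) u - 1) 0.

Definition mixture (R : realType) (d : nat) (w : 'I_(2 ^ d.-1) -> R)
    (u : cube R d) : R :=
  \sum_(k < 2 ^ d.-1) w k * extremal_copula k u.

Definition is_weight (R : realType) (d : nat) (w : 'I_(2 ^ d.-1) -> R) : Prop :=
  (forall k, 0 <= w k) /\ \sum_(k < 2 ^ d.-1) w k = 1.

Definition is_extremal_mixture (R : realType) (d : nat)
    (C : cube R d -> R) : Prop :=
  is_copula C /\ exists2 w, is_weight w & C = mixture w.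

Definition acoef (R : realType) (d : nat) (I : {set 'I_d})
    (k : 'I_(2 ^ d.-1)) : R :=
  ((I \subset Jset k) || (I \subset ~: Jset k))%:R.

Definition avec (R : realType) (d : nat) (k : 'I_(2 ^ d.-1)) :
    {ffun even_set d -> R^o} :=
  [ffun I => acoef R (val I) k].

Section well_definedness.
Context (R : realType) (d : nat).
Implicit Types (P Q : probability (d.-tuple R) R) (I : {set 'I_d}).

Let box (a : 'I_d -> R) : set (d.-tuple R) :=
  [set x | forall j, tnth x j <= a j].

Let measurable_forall dT (T : measurableType dT) (A : pred 'I_d)
    (F : 'I_d -> set T) :
  (forall j, measurable (F j)) ->
  measurable [set t | forall j, A j -> F j t].
Proof.
move=> mF.
have -> : [set t | forall j, A j -> F j t] = \big[setI/setT]_(j | A j) F j.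
  apply/seteqP; split => t /=.
    by move=> h; elim/big_ind : _ => // j Aj; exact: h.
  by move=> h j Aj; move: h; rewrite (bigD1 j)//= => -[].
by elim/big_ind : _ => // *; exact: measurableI.
Qed.

Let measurable_box a : measurable (box a).
Proof.
pose F j : set (d.-tuple R) := (fun x => tnth x j) @^-1` `]-oo, a j].
have -> : box a = [set t | forall j, predT j -> F j t].
  apply/seteqP; split => x /= h j; first by rewrite /F/= in_itv/= h.
  by have := h j isT; rewrite /F/= in_itv.
apply: measurable_forall => j; rewrite /F -[X in measurable X]setTI.
exact: measurable_tnth.
Qed.

Let bounded (x : d.-tuple R) : exists m : nat, forall i, tnth x i <= m%:R.
Proof.
exists (\max_i (Num.truncn `|tnth x i|).+1)%N => i.
apply: (le_trans (ler_norm _)); apply: ltW.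
apply: lt_le_trans (truncnS_gt _) _.
by rewrite ler_nat; exact: (leq_bigmax i).
Qed.

Let measurable_boxE : @measurable _ (d.-tuple R) = <<s range box >>.
Proof.
apply/seteqP; split => A; last first.
  move: A; apply: smallest_sub => /=; first exact: sigma_algebra_measurable.
  by move=> _ [a _ <-]; exact: measurable_box.
pose T := g_sigma_algebraType (range box).
have mt j : measurable_fun [set: T] (fun x : T => tnth x j).
  have mR : @measurable _ R = <<s @RGenOInfty.G R >>.
    exact: RGenOInfty.measurableE.
  apply: (@measurability _ _ T R [set: T] (fun x : T => tnth x j) _ mR).
  move=> _ [_ [a ->] <-]; rewrite setTI.
  have -> : (fun x : T => tnth x j) @^-1` `]a, +oo[ =
      ~` \bigcup_n box (fun i => if i == j then a else n%:R).
    rewrite -set_itvE ?setCK; apply/seteqP; split => x /=.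
      rewrite in_itv/= andbT => ax [n _] /(_ j); rewrite eqxx.
      by rewrite leNgt ax.
    rewrite in_itv/= andbT ltNge => h; apply/negP => xa; apply: h.
    have [m xm] := bounded x.
    by exists m => // i /=; case: eqP => [->//|_].
  apply: measurableC; apply: bigcup_measurable => n _.
  by apply: sub_sigma_algebra; exists (fun i => if i == j then a else n%:R).
have mid : measurable_fun [set: T] (fun x : T => x : d.-tuple R).
  by apply/measurable_fun_tnthP => j; exact: mt.
by move=> mA; have := mid measurableT _ mA; rewrite setTI.
Qed.

Let bad : set (d.-tuple R) :=
  \big[setU/set0]_(j < d) ((fun x => tnth x j) @^-1` (~` `]0, 1])).

Let notbad x : ~ bad x -> forall j, 0 < tnth x j <= 1.
Proof.
move=> nb j; apply: contrapT => h; apply: nb; rewrite /bad.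
by rewrite (bigD1 j)//=; left; rewrite /= in_itv.
Qed.

Let uniform0 : uniform_prob (@ltr01 R) (~` `]0, 1]) = 0%E.
Proof.
rewrite /uniform_prob integral_uniform_pdf.
apply: null_set_integral => //.
- by apply: measurableI => //; exact: measurableC.
- apply: measurable_funTS; apply: measurableT_comp => //.
  exact: measurable_uniform_pdf.
apply/eqP; rewrite -measure_le0 -(lebesgue_measure_set1 (0 : R)).
apply: le_measure; rewrite ?inE//.
- by apply: measurableI => //; exact: measurableC.
- move=> x [] /=; rewrite !in_itv/= => h /andP[x0 x1].
  apply/eqP; rewrite eq_le x0 andbT leNgt; apply/negP => x_gt0.
  by apply: h; rewrite x_gt0 x1.
Qed.

Let bad0 C P : law_of C P -> measurable bad /\ P bad = 0%E.
Proof.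
move=> [_ Pu]; rewrite /bad.
elim/big_ind : _ => [|A B [mA A0] [mB B0]|j _].
- by rewrite measure0.
- by split; [exact: measurableU|exact: null_set_setU].
- have mj : measurable (~` `]0%R, 1%R] : set R) by exact: measurableC.
  split; last by have := Pu j _ mj; rewrite /pushforward uniform0.
  by rewrite -[X in measurable X]setTI; exact: measurable_tnth.
Qed.

Lemma law_of_unique (C : cube R d -> R) P Q : law_of C P -> law_of C Q ->
  forall A, measurable A -> P A = Q A.
Proof.
move=> CP CQ A mA.
pose clamp (r : R) : R := Num.min (Num.max r 0) 1.
have clamp0 r : 0 <= clamp r by rewrite le_min le_max lexx orbT ler01.
have clamp1 r : clamp r <= 1 by rewrite ge_min lexx orbT.
pose c (a : 'I_d -> R) : cube R d := fun j => Itv01 (clamp0 (a j)) (clamp1 (a j)).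
have boxE P' a : law_of C P' -> P' (box a) = (C (c a))%:E.
  move=> CP'; have [mbad Pbad] := bad0 CP'.
  have PD B : measurable B -> P' B = P' (B `\` bad).
    move=> mB; rewrite (measureDI P' mB mbad) [X in (_ + X)%E](_ : _ = 0%E) ?adde0//.
    by apply: (subset_measure0 _ _ _ Pbad) => //; exact: measurableI.
  rewrite -(CP'.1 (c a)) PD// [RHS]PD; last exact: measurable_box.
  congr (P' _); apply/seteqP; split => x [xa xb]; split => // j;
    have /andP[x0 x1] := notbad xb j; have /= := xa j.
    by move=> xaj; rewrite le_min x1 le_max xaj.
  by rewrite le_min x1 andbT le_max (leNgt _ 0) x0 orbF.
have m1 B : range box B -> P B = Q B.
  by move=> [a _ <-]; rewrite !boxE.
apply: (measure_unique (range box) (fun n => box (fun=> n%:R))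
  measurable_boxE) => //.
- move=> _ _ [a _ <-] [b _ <-]; exists (fun j => Num.min (a j) (b j)) => //.
  apply/seteqP; split => x /=.
    by move=> h; split => j; have := h j; rewrite le_min => /andP[].
  by move=> [h1 h2] j; rewrite le_min h1 h2.
- by apply/seteqP; split => // x _; have [m xm] := bounded x; exists m.
- by move=> n; rewrite (le_lt_trans (probability_le1 _ _)) ?ltry//; exact: measurable_box.
Qed.

Lemma measurable_concordant I : measurable (@concordant R d I).
Proof.
have mt j (f : d.-tuple R * d.-tuple R -> d.-tuple R) :
    measurable_fun setT f -> measurable_fun setT (fun p => tnth (f p) j).
  move=> mf; exact: (measurableT_comp (@measurable_tnth _ R d j) mf).
have mle j (f g : d.-tuple R * d.-tuple R -> d.-tuple R) :
    measurable_fun setT f -> measurable_fun setT g ->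
    measurable [set p : d.-tuple R * d.-tuple R | tnth (f p) j <= tnth (g p) j].
  move=> mf mg; rewrite -[X in measurable X]setTI.
  by apply: measurable_fun_le => //; exact: mt.
by apply: measurableU; apply: measurable_forall => j; exact: mle.
Qed.

Lemma kappa_law (C : cube R d -> R) P I : law_of C P -> (1 < #|I|)%N ->
  (P \x P)%E (concordant I) = (kappa C I)%:E.
Proof.
move=> CP I1; rewrite /kappa leqNgt I1/=.
set K := [set r : R | _].
have [Q CQ QE] : K (get K).
  apply: (@getI _ K (fine ((P \x P)%E (concordant I)))); exists P => //.
  rewrite fineK// ge0_fin_numE//; apply: le_lt_trans (ltry 1).
  by apply: probability_le1; exact: measurable_concordant.
rewrite -QE; apply: product_measure_unique; last exact: measurable_concordant.
move=> A B mA mB; transitivity (Q A * Q B)%E; first exact: product_measure1E.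
by congr (_ * _)%E; apply: (law_of_unique CQ CP).
Qed.

Theorem kappaE (C : cube R d -> R) dT (T : measurableType dT)
    (Q : probability T R) (U V : {mfun T >-> d.-tuple R}) I :
  law_of C (distribution Q U) -> law_of C (distribution Q V) ->
  (forall A B, measurable A -> measurable B ->
     Q (U @^-1` A `&` V @^-1` B) = (Q (U @^-1` A) * Q (V @^-1` B))%E) ->
  (1 < #|I|)%N ->
  Q [set t | (forall j, j \in I -> tnth (U t) j <= tnth (V t) j) \/
             (forall j, j \in I -> tnth (V t) j <= tnth (U t) j)] =
  (kappa C I)%:E.
Proof.
move=> CU CV UV I1.
have mUV : measurable_fun [set: T] (fun t => (U t, V t)).
  exact: measurable_fun_pair.
rewrite -(kappa_law CU I1).
pose W : {mfun T >-> (d.-tuple R * d.-tuple R)%type} := mfun_Sub (mem_set mUV).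
transitivity (distribution Q W (concordant I)); first by [].
apply/esym; apply: product_measure_unique; last exact: measurable_concordant.
move=> A B mA mB; transitivity (distribution Q U A * distribution Q V B)%E.
  exact: UV.
by congr (_ * _)%E; apply: (law_of_unique CV CU).
Qed.

End well_definedness.

(* Main.v *)
Require Import Defs.
From HB Require Import structures.
From mathcomp Require Import ring lra zify.

Set Implicit Arguments.
Unset Strict Implicit.
Unset Printing Implicit Defensive.

Local Open Scope ring_scope.

(** Let [U] and [U'] be independent with law [C], and let [comparison_set] be
    the random set of the coordinates [j] with [U_j <= U'_j].  The margins have
    no atoms, so ties are negligible, and [U], [U'] are concordant on [I] exactly
    when [I] lies on one side of the comparison set, that is inside the set or
    inside its complement.  Each set of coordinates is one of [Jset k],
    [~: Jset k] for a single [k] ([Jset_inj], [Jset_surj]); with [w k] the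
    probability of that event, [kappa C I] is the sum of [w k * acoef R I k]
    ([copula_weights]).  So the signature of any copula is a convex combination
    of the vectors [avec R k].

    Conversely the [k]-th extremal copula is the law of the vector with
    coordinates [V] on [Jset k] and [1 - V] elsewhere, for a single uniform [V].
    If [U] is built in this way from [V] and [A], and [U'] from an independent
    [V'] and [B], then [U_j - U'_j] is [V - V'] or [V + V' - 1] up to sign, and
    checking the four cases shows that the comparison set is [A] or [~: A] when
    [V - V'] and [V + V' - 1] have the same sign, and [B] or [~: B] otherwise
    ([one_sided_comparison_antithetic]).  Exchanging [V] and [V'] flips the first
    sign only, so both events have probability [1/2], and the pair is concordant
    on [I] with probability the mean of the values for [A] and for [B]
    ([antithetic_pair]).  For a mixture, the sum over [k] and [l] of
    [w k * w l * (a k + a l) / 2] collapses to that of [w k * a k]: concordance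
    probabilities, quadratic in the law in general, are linear on extremal
    mixtures ([even_signature_mixture]).  The mixture with the weights found
    above therefore has the signature of [C].

    Uniqueness of the weights, hence of the mixture, is the linear independence
    of the [avec R k] ([avec_free]).  Coefficients [v k] amount to a signed
    measure [G] on sets of coordinates that is invariant under complement, and a
    relation between the [avec R k] says that the mass [F I] of the supersets of
    [I] vanishes for even [I].  By inclusion-exclusion, the mass of the sets
    disjoint from [I], which is again [F I], is the alternating sum of [F] over
    the subsets of [I]; for odd [I] this reads [2 * F I = 0] once [F] vanishes on
    smaller sets.  So [F], and with it [G], is zero. *)

(** * Symmetric signed measures on the subsets of a finite set *)

(** Expanding the product of [1 - 1_A i] over the [i] in [I]: the indicator that
    [I] misses [A], written with the indicators that [A] contains a set. *)
Lemma alternating_sum_subsets (R : comNzRingType) (T : finType) (I A : {set T}) :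
  \sum_(K : {set T} | K \subset I) (-1) ^+ #|K| * (K \subset A)%:R
  = (I \subset ~: A)%:R :> R.
Proof.
(* The factors outside [I] are [0 + 1], so that [bigA_distr] over all of [T]
   only keeps the subsets of [I]. *)
transitivity (\prod_(i : T) ((if i \in I then - (i \in A)%:R else 0) + 1) : R).
  rewrite bigA_distr big_mkcond; apply: eq_bigr => K _.
  rewrite -big_mkcond/=; case: ifPn => [KI|/fintype.subsetPn[i iK iI]]; last first.
    by rewrite (bigD1 i)//= (negbTE iI) mul0r.
  rewrite (eq_bigr (fun i => - (i \in A)%:R)); last first.
    by move=> i iK; rewrite (fintype.subsetP KI).
  rewrite prodrN; congr (_ * _).
  case: (boolP (K \subset A)) => [KA|/fintype.subsetPn[i iK iA]].
    by rewrite big1// => i iK; rewrite (fintype.subsetP KA).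
  by rewrite (bigD1 i)//= (negbTE iA) mul0r.
case: (boolP (I \subset ~: A)) => [IA|/fintype.subsetPn[i iI]].
  rewrite big1// => i _; case: ifPn => [iI|_]; last by rewrite add0r.
  by have := fintype.subsetP IA i iI; rewrite inE => /negbTE->; rewrite oppr0 add0r.
rewrite inE negbK => iA.
by rewrite (bigD1 i)//= iI iA addNr mul0r.
Qed.

(** The superset sums are triangular for inclusion: if [G] vanishes on the
    proper supersets of [A], the sum at [A] is [G A]. *)
Lemma superset_sums_inj (V : zmodType) (T : finType) (G : {set T} -> V) :
  (forall I : {set T}, \sum_(A : {set T} | I \subset A) G A = 0) ->
  forall A, G A = 0.
Proof.
move=> F0 A; have [n] := ubnP #|~: A|; elim: n A => // n IH A An.
have := F0 A; rewrite (bigD1 A)//= big1 ?addr0// => B /andP[AB BA].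
apply: IH; rewrite -ltnS; apply: leq_trans An; rewrite ltnS proper_card//.
by rewrite properC finset.properEneq eq_sym BA.
Qed.

(** For [G] invariant under complement, the superset sums at odd sets are
    determined by those at even sets, so the even ones suffice to recover [G].
    This is why only even sets enter the signature. *)
Lemma symmetric_even_inj (R : numDomainType) (T : finType) (G : {set T} -> R) :
  (forall A, G (~: A) = G A) ->
  (forall I : {set T}, ~~ odd #|I| -> \sum_(A : {set T} | I \subset A) G A = 0) ->
  forall A, G A = 0.
Proof.
move=> Gsym even0; apply: superset_sums_inj => I.
pose F (I : {set T}) := \sum_(A : {set T} | I \subset A) G A; rewrite -/(F I).
have [n] := ubnP #|I|; elim: n I => // n IH I In.
case: (boolP (odd #|I|)) => [Iodd|]; last exact: even0.
(* By symmetry [F I] is also the mass of the sets disjoint from [I]. *)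
have FI : F I = \sum_(K : {set T} | K \subset I) (-1) ^+ #|K| * F K.
  transitivity (\sum_A G A * (I \subset ~: A)%:R).
    rewrite (reindex_inj (inv_inj (@finset.setCK T)))/= /F big_mkcond.
    by apply: eq_bigr => A _; rewrite finset.setCK Gsym; case: ifP; rewrite ?mulr1 ?mulr0.
  under eq_bigr do rewrite -alternating_sum_subsets mulr_sumr.
  rewrite exchange_big/=; apply: eq_bigr => K _.
  rewrite /F [in RHS]big_mkcond mulr_sumr; apply: eq_bigr => A _.
  by case: ifP => _; rewrite ?mulr1 ?mulr0// mulrC.
move: FI; rewrite (bigD1 I)//= big1 => [|K /andP[KI KnI]]; last first.
  rewrite IH ?mulr0// -ltnS; apply: leq_trans In; rewrite ltnS proper_card//.
  by rewrite finset.properEneq KnI.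
(* Only the term at [K = I] is left: [F I = - F I]. *)
rewrite addr0 -signr_odd Iodd expr1 mulN1r => /eqP.
by rewrite -addr_eq0 -mulr2n mulrn_eq0 => /eqP.
Qed.

(** * The sets J_k and their incidence vectors *)

Lemma eq_from_parities n (k l : nat) : (k < 2 ^ n)%N -> (l < 2 ^ n)%N ->
  (forall i, (i < n)%N -> odd (k %/ 2 ^ i) = odd (l %/ 2 ^ i)) -> k = l.
Proof.
elim: n k l => [|n IH] k l; first by rewrite expn0 !ltnS !leqn0 => /eqP-> /eqP->.
move=> kn ln kl.
have k2 m : (m < 2 ^ n.+1 -> m %/ 2 < 2 ^ n)%N.
  by rewrite ltn_divLR// -expnSr.
rewrite (divn_eq k 2) (divn_eq l 2) !modn2; congr (_ * 2 + nat_of_bool _)%N.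
  by apply: IH; [exact: k2|exact: k2|] => i ilt; rewrite -!divnMA -!expnS kl.
by have := kl 0%N isT; rewrite expn0 !divn1.
Qed.

Section Jset.
Variable n : nat.
Implicit Types k l : 'I_(2 ^ n.+1.-1).

(** The leading digit is [0] because [k < 2 ^ n]; this is what tells [Jset k]
    from the complements. *)
Lemma Jset0 k : ord0 \in Jset k.
Proof. by rewrite inE subn0 divn_small. Qed.

Lemma Jset_inj : injective (@Jset n.+1).
Proof.
move=> k l kl; apply/val_inj/(@eq_from_parities n); [exact: ltn_ord..|].
move=> i iltn; have jlt : (n - i < n.+1)%N by lia.
have /setP/(_ (Ordinal jlt)) := kl; rewrite !inE/= subKn ?(ltnW iltn)//.
exact: negb_inj.
Qed.

Lemma Jset_eqC k l : (Jset k == ~: Jset l) = false.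
Proof.
apply/eqP => /setP/(_ ord0).
by rewrite [in RHS]inE !Jset0.
Qed.

(** The [2 ^ n] sets [Jset k] and their complements are distinct, and they are
    as many as the subsets of ['I_n.+1]. *)
Lemma Jset_surj (A : {set 'I_n.+1}) :
  exists k, (A == Jset k) || (A == ~: Jset k).
Proof.
pose f (p : 'I_(2 ^ n) * bool) : {set 'I_n.+1} :=
  if p.2 then Jset (p.1 : 'I_(2 ^ n.+1.-1)) else ~: Jset (p.1 : 'I_(2 ^ n.+1.-1)).
have finj : injective f.
  move=> [k b] [l c]; rewrite /f/=; case: b; case: c.
  - by move=> /Jset_inj ->.
  - by move=> /eqP; rewrite Jset_eqC.
  - by move=> /esym/eqP; rewrite Jset_eqC.
  - by move=> /(inv_inj (@finset.setCK _))/Jset_inj ->.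
have [|g gK fK] := inj_card_bij finj.
  by rewrite card_prod card_bool card_ord -finset.cardsT -powersetT card_powerset finset.cardsT card_ord expnSr.
exists (g A).1; rewrite -[A in A == _]fK -[A in _ || (A == _)]fK /f.
by case: (g A).2; rewrite eqxx ?orbT.
Qed.

End Jset.

(** A linear relation between the incidence vectors says that a complement
    invariant signed measure, with masses [v k], has vanishing superset sums at
    the even sets; this carries the uniqueness of the weights. *)
Lemma avec_free (R : realType) n (v : 'I_(2 ^ n.+1.-1) -> R) :
  (forall I : {set 'I_n.+1}, ~~ odd #|I| -> \sum_k v k * acoef R I k = 0) ->
  forall k, v k = 0.
Proof.
move=> v0 l.
(* [G] puts the mass [v k] on both [Jset k] and its complement. *)
pose G A : R := \sum_k v k * ((A == Jset k)%:R + (A == ~: Jset k)%:R).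
have -> : v l = G (Jset l).
  rewrite /G (bigD1 l)//= eqxx Jset_eqC addr0 mulr1 big1 ?addr0// => k kl.
  by rewrite Jset_eqC (inj_eq (@Jset_inj n)) eq_sym (negbTE kl) addr0 mulr0.
apply: symmetric_even_inj => [A|I Ieven].
  apply: eq_bigr => k _; rewrite addrC; congr (_ * (_%:R + _%:R)).
    by rewrite (inj_eq (inv_inj (@finset.setCK _))).
  by rewrite (can2_eq (@finset.setCK _) (@finset.setCK _)).
have sumE B : \sum_(A : {set 'I_n.+1} | I \subset A) ((A == B)%:R : R) = (I \subset B)%:R.
  case: (boolP (I \subset B)) => IB.
    rewrite (bigD1 B)//= eqxx big1 ?addr0// => A /andP[_].
    by move=> /negbTE ->.
  by rewrite big1// => A IA; case: eqP IB => // <-; rewrite IA.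
transitivity (\sum_k v k * ((I \subset Jset k)%:R + (I \subset ~: Jset k)%:R)).
  rewrite exchange_big/=; apply: eq_bigr => k _.
  by rewrite -mulr_sumr big_split/= !sumE.
(* [I] can lie in [Jset k] and in its complement only if it is empty, where
   [acoef] counts one and the sum of indicators two. *)
have [->|I0] := eqVneq I finset.set0.
  have := v0 finset.set0; rewrite cards0 => /(_ isT) v00.
  under eq_bigr do rewrite !finset.sub0set mulrDr.
  rewrite big_split/=.
  rewrite -[RHS](addr0 0) -[in X in _ = X + _]v00 -[in X in _ = _ + X]v00.
  by congr (_ + _); apply: eq_bigr => k _; rewrite /acoef !finset.sub0set.
rewrite -[RHS](v0 I Ieven); apply: eq_bigr => k _; congr (_ * _).
rewrite /acoef; case: (boolP (I \subset Jset k)) => IJ/=; last by rewrite add0r.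
have [i iI] := finset.set0Pn _ I0.
case: (boolP (I \subset _)) => IC; last by rewrite addr0.
by have := fintype.subsetP IC i iI; rewrite inE (fintype.subsetP IJ).
Qed.

(** * Null sets, measurability and product measures *)

Local Open Scope classical_set_scope.

Section measure_facts.
Context {R : realType}.

Lemma eq_measure_off_null dT (T : measurableType dT)
    (mu : {measure set T -> \bar R}) (A B N : set T) :
  measurable A -> measurable B -> measurable N -> mu N = 0%E ->
  (forall t, ~ N t -> A t <-> B t) -> mu A = mu B.
Proof.
move=> mA mB mN N0 AB.
rewrite -(measureU0 mA mN N0) -(measureU0 mB mN N0); congr (mu _).
apply/seteqP; split => t /= -[H|]; try by right.
  by have [Nt|/AB [h _]] := pselect (N t); [right|left; exact: h].
by have [Nt|/AB [_ h]] := pselect (N t); [right|left; exact: h].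
Qed.

Lemma measurable_coincidence dT (T : measurableType dT) (f g : T -> R) :
  measurable_fun setT f -> measurable_fun setT g ->
  measurable [set t | f t = g t].
Proof.
move=> mf mg.
rewrite [X in measurable X](_ : _ = (fun t => f t == g t) @^-1` [set true]).
  by rewrite -[X in measurable X]setTI; exact: measurable_fun_eqr.
by apply/seteqP; split => t /= /eqP.
Qed.

(** By Fubini: the section at [x] is the event that [g] takes the value [f x]. *)
Lemma coincidence_null dT dT' (T : measurableType dT) (T' : measurableType dT')
    (P : probability T R) (Q : probability T' R) (f : T -> R) (g : T' -> R) :
  (forall r, Q (g @^-1` [set r]) = 0%E) ->
  (P \x Q)%E [set p | f p.1 = g p.2] = 0%E.
Proof.
move=> g0; rewrite /= /product_measure1 integral0_eq// => x _ /=.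
rewrite -[RHS](g0 (f x)); congr (Q _).
by apply/seteqP; split => y; rewrite /xsection/= inE.
Qed.

Lemma measurable_finset_preimage dT (T : measurableType dT) (J : finType)
    (s : T -> {set J}) (B : pred {set J}) :
  (forall j, measurable [set t | j \in s t]) -> measurable [set t | B (s t)].
Proof.
move=> ms.
have meq A : measurable [set t | s t = A].
  have -> : [set t | s t = A] = \big[setI/setT]_j
      (if j \in A then [set t | j \in s t] else ~` [set t | j \in s t]).
    apply/seteqP; split => t /=.
      by move=> stA; elim/big_ind : _ => // j _; rewrite -stA; case: ifPn => // /negP.
    move=> h; apply/setP => j; move: h; rewrite (bigD1 j)//= => -[+ _].
    by case: ifP => //= _ /negP/negbTE.
  elim/big_ind : _ => // [X Y mX mY|j _]; first exact: measurableI.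
  by case: ifP => _; [|apply: measurableC]; exact: ms.
have -> : [set t | B (s t)] = \big[setU/set0]_(A | B A) [set t | s t = A].
  apply/seteqP; split => t /=; first by move=> Bt; rewrite (bigD1 (s t))//=; left.
  by elim/big_ind : _ => // [X Y hX hY [/hX|/hY]//|A BA /= ->].
by elim/big_ind : _ => // [X Y mX mY]; exact: measurableU.
Qed.

Lemma product_measure_swap dT (X : measurableType dT) (P : probability X R)
    (E : set (X * X)) : measurable E ->
  (P \x P)%E ((fun p => (p.2, p.1)) @^-1` E) = (P \x P)%E E.
Proof.
move=> mE.
have msw : measurable_fun [set: X * X] (fun p : X * X => (p.2, p.1)).
  exact: measurable_fun_pair.
pose sw : {mfun (X * X)%type >-> (X * X)%type} := mfun_Sub (mem_set msw).
transitivity (distribution (P \x P)%E sw E); first by [].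
apply/esym/product_measure_unique => // U V mU mV.
transitivity ((P \x P)%E (V `*` U)).
  congr ((P \x P)%E _); apply/seteqP; split => p /= []; by split.
by rewrite product_measure1E// muleC.
Qed.

Lemma probability_half dT (X : measurableType dT) (P : probability X R)
    (E : set X) : measurable E -> P (~` E) = P E -> P E = (2^-1)%:E.
Proof.
move=> mE; rewrite probability_setC//.
have : P E \is a fin_num by exact: fin_num_measure.
move: (P E) => [r| |]// _; rewrite -EFinB => -[r1].
by congr _%:E; lra.
Qed.

End measure_facts.

(** * The uniform law and its reflection *)

Section uniform.
Context {R : realType}.
Local Notation lam := (uniform_prob (@ltr01 R)).

Lemma uniform_prob_set1 (r : R) : lam [set r] = 0%E.
Proof.
have /null_content_dominatesP := dominates_uniform_prob (@ltr01 R).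
by apply => //; exact: lebesgue_measure_set1.
Qed.

Lemma uniform_prob01E (A : set R) : measurable A ->
  lam A = lebesgue_measure (A `&` `[0, 1]).
Proof.
move=> mA; rewrite /uniform_prob integral_uniform_pdf.
rewrite (eq_integral (cst 1%:E)); last first.
  by move=> x /[1!inE]-[_ /=]; rewrite in_itv/= /uniform_pdf subr0 invr1 => ->.
by rewrite integral_cst ?mul1e//; exact: measurableI.
Qed.

Lemma lebesgue_measure_reflect (c : R) (A : set R) : measurable A ->
  lebesgue_measure ((fun v => c - v) @^-1` A) = lebesgue_measure A.
Proof.
have mc : measurable_fun [set: measurableTypeR R]
    ((fun v => c - v) : measurableTypeR R -> measurableTypeR R).
  exact: measurable_funB.
move=> mA.
apply/esym/(@lebesgue_measure_unique R (pushforward lebesgue_measure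
  ((fun v => c - v) : measurableTypeR R -> measurableTypeR R))) => //.
move=> _ [[a b] _ <-] /=; rewrite /pushforward.
rewrite [X in _ = _ X](_ : _ = `[c - b, c - a[%classic); last first.
  apply/seteqP; split => v /=; rewrite !in_itv/= => /andP[h1 h2]; apply/andP; split; lra.
rewrite !lebesgue_measure_itv/= !lte_fin.
have -> : (c - b < c - a) = (a < b) by apply/idP/idP; lra.
by case: ifP => // _; congr _%:E; lra.
Qed.

Lemma uniform_prob_reflect (A : set R) : measurable A ->
  lam ((fun v => 1 - v) @^-1` A) = lam A.
Proof.
move=> mA.
have mr : measurable_fun [set: R] (fun v : R => 1 - v) by exact: measurable_funB.
rewrite !uniform_prob01E//; last by rewrite -[X in measurable X]setTI; exact: mr.
rewrite -(lebesgue_measure_reflect 1 (measurableI _ _ mA (measurable_itv _))).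
congr lebesgue_measure; rewrite preimage_setI; congr (_ `&` _).
by apply/seteqP; split => v /=; rewrite !in_itv/= => /andP[h1 h2]; apply/andP; split; lra.
Qed.

Lemma uniform_prob_itvcc (a b : R) : 0 <= a -> b <= 1 ->
  lam `[a, b] = (Num.max (b - a) 0)%:E.
Proof.
move=> a0 b1; rewrite uniform_prob01E// setIidl; last first.
  by move=> x /=; rewrite !in_itv/= => /andP[ax xb]; apply/andP; split; lra.
rewrite lebesgue_measure_itv/= lte_fin; case: ltP => ab.
  by rewrite max_l//; lra.
by rewrite max_r//; lra.
Qed.

End uniform.

(** * Concordance and the comparison set *)

(** When [A] records the coordinates where one point is below another,
    [one_sided I A] is concordance on [I]; when [A] is [Jset k], it is the
    condition [a_(I,k) = 1]. *)
Definition one_sided (T : finType) (I A : {set T}) :=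
  (I \subset A) || (I \subset ~: A)%SET.

Definition comparison_set (R : realType) (d : nat)
    (p : d.-tuple R * d.-tuple R) : {set 'I_d} :=
  [set j | tnth p.1 j <= tnth p.2 j]%SET.

Section comparison.
Context {R : realType} {n : nat}.
Local Notation d := n.+1.
Implicit Types (P Q : probability (d.-tuple R) R) (I : {set 'I_d}).

Let measurable_coord (f : d.-tuple R * d.-tuple R -> d.-tuple R) j :
  measurable_fun setT f -> measurable_fun setT (fun p => tnth (f p) j).
Proof. by move=> mf; exact: (measurableT_comp (@measurable_tnth _ R d j) mf). Qed.

Lemma measurable_comparison_set (B : pred {set 'I_d}) :
  measurable [set p : d.-tuple R * d.-tuple R | B (comparison_set p)].
Proof.
apply: measurable_finset_preimage => j.
rewrite [X in measurable X](_ : _ = [set p | tnth p.1 j <= tnth p.2 j]).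
  by rewrite -[X in measurable X]setTI; apply: measurable_fun_le => //; exact: measurable_coord.
by apply/seteqP; split => p /=; rewrite inE.
Qed.

(** Off the null set of ties, [~ (x_j <= y_j)] is the same as [y_j <= x_j]. *)
Lemma concordant_comparison P Q I :
  (forall j r, Q [set x | tnth x j = r] = 0%E) ->
  (P \x Q)%E (concordant I) = (P \x Q)%E [set p | one_sided I (comparison_set p)].
Proof.
move=> Q0.
pose tie : set (d.-tuple R * d.-tuple R) :=
  \big[setU/set0]_(j < d) [set p | tnth p.1 j = tnth p.2 j].
have [mtie tie0] : measurable tie /\ (P \x Q)%E tie = 0%E.
  rewrite /tie; elim/big_ind : _ => [|A B [mA A0] [mB B0]|j _].
  - by rewrite measure0.
  - by split; [exact: measurableU|exact: null_set_setU].
  - split; first by apply: measurable_coincidence; exact: measurable_coord.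
    exact: (@coincidence_null _ _ _ _ _ P Q
      (fun x => tnth x j) (fun x => tnth x j) (Q0 j)).
apply: (eq_measure_off_null _ _ mtie tie0).
- exact: measurable_concordant.
- exact: (measurable_comparison_set (one_sided I)).
move=> p ntie; split=> [[h|h]|/orP[/fintype.subsetP h|/fintype.subsetP h]].
- by apply/orP; left; apply/fintype.subsetP => j jI; rewrite inE h.
- apply/orP; right; apply/fintype.subsetP => j jI; rewrite !inE -ltNge lt_neqAle h// andbT.
  apply/eqP => yx; apply: ntie.
  by rewrite /tie (bigD1 j)//=; left.
- by left => j /h; rewrite inE.
- by right => j /h; rewrite !inE -ltNge => /ltW.
Qed.

Lemma one_sidedC I (A : {set 'I_d}) : one_sided I (~: A)%SET = one_sided I A.
Proof. by rewrite /one_sided finset.setCK orbC. Qed.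

Lemma one_sided_small I (A : {set 'I_d}) : (#|I| <= 1)%N -> one_sided I A.
Proof.
have [->|[j jI]] := set_0Vmem I; first by rewrite /one_sided finset.sub0set.
move=> I1; have -> : I = [set j]%SET.
  by apply/esym/eqP; rewrite eqEcard finset.sub1set jI cards1.
by rewrite /one_sided !finset.sub1set finset.in_setC orbN.
Qed.

Lemma acoefE I (k : 'I_(2 ^ d.-1)) : acoef R I k = (one_sided I (Jset k))%:R.
Proof. by []. Qed.

(** The convention [kappa C I = 1] for small [I] agrees with the coefficients,
    which are all [1] there. *)
Lemma kappa_small (C : cube R d -> R) I (w : 'I_(2 ^ d.-1) -> R) :
  (#|I| <= 1)%N -> \sum_k w k = 1 -> kappa C I = \sum_k w k * acoef R I k.
Proof.
move=> I1 w1; rewrite /kappa I1 -w1; apply: eq_bigr => k _.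
by rewrite acoefE one_sided_small// mulr1.
Qed.

(** [w k] is the probability that the comparison set of two independent points
    is [Jset k] or its complement. *)
Lemma copula_weights (C : cube R d -> R) : is_copula C ->
  exists2 w : 'I_(2 ^ d.-1) -> R, is_weight w &
    forall I, kappa C I = \sum_k w k * acoef R I k.
Proof.
move=> [P CP].
pose pat (k : 'I_(2 ^ d.-1)) : set (d.-tuple R * d.-tuple R) :=
  [set p | (comparison_set p == Jset k) || (comparison_set p == ~: Jset k)%SET].
have mpat k : measurable (pat k).
  exact: (measurable_comparison_set (fun A => (A == Jset k) || (A == ~: Jset k)%SET)).
have tpat : trivIset setT pat.
  apply/trivIsetP => k l _ _ kl; apply/seteqP; split => // p /=.
  rewrite /pat/= => -[/orP[]/eqP -> /orP[]].
  - by rewrite (inj_eq (@Jset_inj n)) (negbTE kl).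
  - by rewrite Jset_eqC.
  - by rewrite eq_sym Jset_eqC.
  - by rewrite (inj_eq (inv_inj (@finset.setCK _))) (inj_eq (@Jset_inj n)) (negbTE kl).
pose w k := fine ((P \x P)%E (pat k)).
have wE k : (w k)%:E = (P \x P)%E (pat k).
  rewrite /w fineK// ge0_fin_numE//; apply: le_lt_trans (ltry 1).
  by apply: probability_le1; exact: mpat.
have sumE (B : pred {set 'I_d}) : (forall A, B (~: A)%SET = B A) ->
    (P \x P)%E [set p | B (comparison_set p)] = (\sum_(k | B (Jset k)) w k)%:E.
  move=> BC; rewrite -sumEFin; under eq_bigr do rewrite wE.
  rewrite -measure_bigsetU_ord//; congr ((P \x P)%E _).
  apply/seteqP; split => p /=.
    have [k /[dup] pk /orP[]/eqP->] := Jset_surj (comparison_set p).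
      by move=> Bk; rewrite (bigD1 k)//=; left.
    by rewrite BC => Bk; rewrite (bigD1 k)//=; left.
  elim/big_ind : _ => // [X Y hX hY [/hX|/hY]//|k Bk].
  by case/orP => /eqP ->; rewrite ?BC.
have w0 k : 0 <= w k by rewrite fine_ge0.
have w1 : \sum_k w k = 1.
  apply: EFin_inj; rewrite -(sumE predT)//.
  rewrite (_ : [set p | _] = setT); first exact: probability_setT.
  by apply/seteqP; split.
exists w => // I.
have [I1|I1] := ltnP 1 #|I|; last exact: kappa_small.
apply: EFin_inj; rewrite -(kappa_law CP I1) concordant_comparison.
  rewrite (sumE (one_sided I)) ?big_mkcond; last exact: one_sidedC.
  congr _%:E; apply: eq_bigr => k _; rewrite acoefE.
  by case: ifP; rewrite ?mulr1 ?mulr0.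
by move=> j r; have := CP.2 j [set r]; rewrite uniform_prob_set1 => <-.
Qed.

End comparison.

(** * Finite mixtures of probability measures *)

(** The sum is normalized only to get a term of type [probability]; its total
    mass is already [1].  The formula for integrals is needed besides the one
    for events because a product measure is the integral of its sections. *)
Lemma convex_combination (R : realType) dT (T : measurableType dT) (N : nat)
    (P : 'I_N -> probability T R) (w : 'I_N -> R) :
  (forall k, 0 <= w k) -> \sum_k w k = 1 ->
  exists Q : probability T R,
    (forall A, Q A = \sum_k (w k)%:E * P k A)%E /\
    (forall f : T -> \bar R, measurable_fun setT f -> (forall x, 0 <= f x)%E ->
       (\int[Q]_x f x = \sum_k (w k)%:E * \int[P k]_x f x)%E).
Proof.
case: N P w => [|N] P w w0 w1.
  by move: w1; rewrite big_ord0 => /esym/eqP; rewrite oner_eq0.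
pose m (i : nat) : {measure set T -> \bar R} :=
  if insub i is Some k then mscale (NngNum (w0 k)) (P k) else mzero.
pose mu := msum m N.+1.
have muE A : mu A = (\sum_k (w k)%:E * P k A)%E.
  by rewrite /mu /msum; apply: eq_bigr => k _; rewrite /m valK.
have muT : mu setT = 1%E.
  rewrite muE; under eq_bigr do rewrite probability_setT mule1.
  by rewrite sumEFin w1.
have norm1 (nu : {measure set T -> \bar R}) : nu setT = 1%E ->
    exists Q : probability T R, Q = nu :> (set T -> \bar R).
  move=> nuT; exists (mnormalize nu (P ord0)); apply/funext => A.
  by rewrite /= /mnormalize nuT onee_eq0/= invr1 mule1.
have [Q QE] := norm1 mu muT.
exists Q; rewrite QE; split => [A|f mf f0]; first exact: muE.
rewrite ge0_integral_measure_sum//; apply: eq_bigr => k _.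
by rewrite /m valK ge0_integral_mscale.
Qed.

(** The product is bilinear in its two factors. *)
Lemma product_convex_combination (R : realType) dT (T : measurableType dT) (N : nat)
    (P : 'I_N -> probability T R) (Q : probability T R) (w : 'I_N -> R) (E : set (T * T)) :
  (forall k, 0 <= w k) ->
  (forall A, Q A = \sum_k (w k)%:E * P k A)%E ->
  (forall f : T -> \bar R, measurable_fun setT f -> (forall x, 0 <= f x)%E ->
       (\int[Q]_x f x = \sum_k (w k)%:E * \int[P k]_x f x)%E) ->
  measurable E ->
  (Q \x Q)%E E = (\sum_k \sum_l (w k)%:E * ((w l)%:E * (P k \x P l) E))%E.
Proof.
move=> w0 QE Qint mE; rewrite [LHS]/= {1}/product_measure1 Qint//; last exact: measurable_fun_xsection.
apply: eq_bigr => k _.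
have pk0 l : (0 <= (w l)%:E * (P k \x P l) E)%E by rewrite mule_ge0// lee_fin.
rewrite -ge0_sume_distrr//; congr (_ * _)%E.
under eq_integral do rewrite /= QE.
rewrite ge0_integral_sum//.
- apply: eq_bigr => l _; rewrite ge0_integralZl//; [exact: measurable_fun_xsection|by rewrite lee_fin].
- by move=> l; apply: emeasurable_funM => //; exact: measurable_fun_xsection.
- by move=> l x _; rewrite mule_ge0// lee_fin.
Qed.

(** * The laws of the extremal copulas *)

Section antithetic.
Context {R : realType} {n : nat}.
Local Notation d := n.+1.
Local Notation lam := (uniform_prob (@ltr01 R)).
Implicit Types (A B I : {set 'I_d}).

(** All the randomness comes from one variable [v]: coordinates are
    comonotone inside [A] and inside its complement, and countermonotone across.
    The domain is spelled [measurableTypeR R] because it is the type that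
    carries [uniform_prob]. *)
Definition antithetic A (v : measurableTypeR R) : d.-tuple R :=
  [tuple if j \in A then v else 1 - v | j < d].

Lemma measurable_antithetic A : measurable_fun [set: measurableTypeR R] (antithetic A).
Proof.
apply/measurable_fun_tnthP => j.
have -> : (fun x : d.-tuple R => tnth x j) \o antithetic A =
    fun v : measurableTypeR R => if j \in A then v else 1 - v.
  by apply/funext => v /=; rewrite tnth_mktuple.
by case: (j \in A) => //; exact: measurable_funB.
Qed.

HB.instance Definition _ A :=
  isMeasurableFun.Build _ _ _ _ (antithetic A) (measurable_antithetic A).

Definition antithetic_law A : probability (d.-tuple R) R :=
  distribution lam (antithetic A).

Lemma antithetic_law_margin A j (E : set R) : measurable E ->
  pushforward (antithetic_law A) (fun x => tnth x j) E = lam E.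
Proof.
move=> mE; rewrite -[RHS](_ : lam ((fun v => if j \in A then v else 1 - v) @^-1` E) = _).
  rewrite /antithetic_law /distribution /pushforward; congr (lam _).
  by apply/seteqP; split => v /=; rewrite tnth_mktuple.
by case: (j \in A) => //; exact: uniform_prob_reflect.
Qed.

Lemma antithetic_law_set1 A j (r : R) :
  antithetic_law A [set x | tnth x j = r] = 0%E.
Proof. by have := @antithetic_law_margin A j [set r]; rewrite uniform_prob_set1 => <-. Qed.

Lemma min_over_ge (J : {set 'I_d}) (u : cube R d) (v : R) : v <= 1 ->
  (v <= min_over J u) = [forall j in J, v <= (u j)%:num].
Proof.
move=> v1; apply/idP/forall_inP => [h j jJ|h].
  by move: h; rewrite /min_over (bigD1 j)//= le_min => /andP[].
by rewrite /min_over; elim/big_ind : _ => // x y vx vy; rewrite le_min vx.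
Qed.

(** Inside [0, 1] the box is [1 - min over ~: A <= v <= min over A], an interval
    whose length is the formula of the extremal copula. *)
Lemma antithetic_law_box A (u : cube R d) :
  antithetic_law A [set x | forall j, tnth x j <= (u j)%:num] =
  (Num.max (min_over A u + min_over (~: A)%SET u - 1) 0)%:E.
Proof.
have m01 (J : {set 'I_d}) : 0 <= min_over J u <= 1.
  rewrite /min_over; elim/big_ind : _ => [|x y /andP[x0 x1] /andP[y0 y1]|j _].
  - by rewrite ler01 lexx.
  - by rewrite le_min x0 y0 ge_min x1.
  - by rewrite ge0 le1.
have /andP[a0 a1] := m01 A; have /andP[b0 b1] := m01 (~: A)%SET.
rewrite -addrA (_ : _ + (_ - 1) = min_over A u - (1 - min_over (~: A)%SET u)); last by lra.
rewrite -uniform_prob_itvcc//; last by lra.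
(* The two events only agree inside [0, 1], where the density lives. *)
rewrite /antithetic_law /distribution /pushforward /uniform_prob.
rewrite [LHS]integral_uniform_pdf [RHS]integral_uniform_pdf; congr integral.
apply/seteqP; split => v /= [h]; rewrite !in_itv/= => v01; split => //.
  have /andP[v0 v1] := v01; apply/andP; split.
    suff : 1 - v <= min_over (~: A)%SET u by lra.
    rewrite min_over_ge; last by lra.
    by apply/forall_inP => j; rewrite inE => /negbTE jA; move: (h j); rewrite tnth_mktuple jA.
  rewrite min_over_ge//.
  by apply/forall_inP => j jA; have := h j; rewrite tnth_mktuple jA.
have /andP[v0 v1] := v01; move: h; rewrite in_itv/= => /andP[h1 h2] j.
rewrite tnth_mktuple; case: ifPn => jA.
  by move: h2; rewrite min_over_ge// => /forall_inP; exact.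
have : 1 - v <= min_over (~: A)%SET u by lra.
by rewrite min_over_ge; [move=> /forall_inP; apply; rewrite inE|lra].
Qed.

End antithetic.

(** * Concordance of two independent antithetic vectors *)

Section pair.
Context {R : realType} {n : nat}.
Local Notation d := n.+1.
Local Notation T := (measurableTypeR R).
Local Notation lam := (uniform_prob (@ltr01 R)).
Implicit Types (A B I : {set 'I_d}).

(** Equality of the signs of [v - v'] and [v + v' - 1], at the points
    [(v, v')] off [diagonals]. *)
Definition same_sign (p : T * T) : bool := (p.1 < p.2) == (p.1 + p.2 < 1).

Definition diagonals : set (T * T) :=
  [set p | p.1 = p.2] `|` [set p | p.1 = 1 - p.2].

Let measurable_diagonal :
  measurable [set p : T * T | p.1 = p.2] /\
  measurable [set p : T * T | p.1 = 1 - p.2].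
Proof.
by split; apply: measurable_coincidence => //; exact: measurable_funB.
Qed.

Lemma measurable_diagonals : measurable diagonals.
Proof. by case: measurable_diagonal => m1 m2; exact: measurableU. Qed.

Lemma diagonals_null : (lam \x lam)%E diagonals = 0%E.
Proof.
case: measurable_diagonal => m1 m2; apply: null_set_setU => //.
- apply: (@coincidence_null _ _ _ _ _ lam lam id id) => r.
  exact: uniform_prob_set1.
- apply: (@coincidence_null _ _ _ _ _ lam lam id (fun v => 1 - v)) => r.
  rewrite -[RHS](uniform_prob_set1 (1 - r)); congr (lam _).
  by apply/seteqP; split => v /=; lra.
Qed.

Lemma measurable_same_sign : measurable [set p | same_sign p].
Proof.
have mlt (f g : T * T -> T) : measurable_fun setT f -> measurable_fun setT g ->
    measurable [set p | f p < g p].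
  move=> mf mg; rewrite [X in measurable X](_ : _ = (fun p => f p < g p) @^-1` [set true])//.
  by rewrite -[X in measurable X]setTI; exact: measurable_fun_ltr.
have m1 := mlt _ _ measurable_fst measurable_snd.
have m2 : measurable [set p : T * T | p.1 + p.2 < 1].
  by apply: mlt => //; exact: measurable_funD.
rewrite (_ : [set p | _] = ([set p | p.1 < p.2] `&` [set p | p.1 + p.2 < 1]) `|`
   (~` [set p | p.1 < p.2] `&` ~` [set p | p.1 + p.2 < 1])).
  by apply: measurableU; apply: measurableI => //; exact: measurableC.
apply/seteqP; split => p /=; rewrite /same_sign.
  by case: (p.1 < p.2); case: (p.1 + p.2 < 1) => //= _; [left|right].
by case: (p.1 < p.2); case: (p.1 + p.2 < 1) => //= -[[]|[]].
Qed.

(** Exchanging [v] and [v'] preserves the product law and maps this event to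
    its complement: it changes the sign of [v - v'] but not that of
    [v + v' - 1]. *)
Lemma same_sign_half : (lam \x lam)%E [set p | same_sign p] = (2^-1)%:E /\
  (lam \x lam)%E (~` [set p | same_sign p]) = (2^-1)%:E.
Proof.
have mS := measurable_same_sign.
have SC : (lam \x lam)%E (~` [set p | same_sign p]) = (lam \x lam)%E [set p | same_sign p].
  rewrite -(product_measure_swap _ mS).
  apply: (eq_measure_off_null _ _ measurable_diagonals diagonals_null).
  - exact: measurableC.
  - rewrite -[X in measurable X]setTI.
    by apply: (measurable_fun_pair measurable_snd measurable_fst).
  - move=> [v v'] /= ND; rewrite /same_sign/= [v' + v]addrC.
    have ne : v != v' by apply/eqP => e; apply: ND; left.
    have -> : (v' < v) = ~~ (v < v') by rewrite -leNgt lt_neqAle eq_sym ne.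
    by case: (v < v'); case: (_ < 1); split.
have half := probability_half mS SC.
by split; [exact: half|exact: etrans SC half].
Qed.

(** At a coordinate where [A] and [B] agree the sign compared is that of
    [v - v'], elsewhere that of [v + v' - 1], with a change of sign when the
    coordinate is not in [A].  If the two signs agree, the outcome thus depends
    on [A] only.  If they differ, the outcome is read off from [v - v'] alone
    with [B] in the place of [A]. *)
Lemma one_sided_comparison_antithetic A B I (p : T * T) : ~ diagonals p ->
  one_sided I (comparison_set (antithetic A p.1, antithetic B p.2)) =
  if same_sign p then one_sided I A else one_sided I B.
Proof.
case: p => v v' /= ND.
have n1 : v != v' by apply/eqP => e; apply: ND; left.
have n2 : v + v' != 1 by apply/eqP => e; apply: ND; right => /=; lra.
have -> : comparison_set (antithetic A v, antithetic B v') =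
    (if same_sign (v, v') then (if v < v' then A else ~: A)
     else (if v < v' then B else ~: B))%SET.
  apply/setP => j; rewrite inE/= !tnth_mktuple /same_sign/=.
  case: (ltrgtP v v') n1 => // h1 _; case: (ltrgtP (v + v') 1) n2 => // h2 _ /=;
  rewrite ?inE; case: (j \in A); case: (j \in B) => /=; apply/idP/idP => //; lra.
by rewrite /same_sign/=; case: (v < v'); case: (_ < 1) => //=; rewrite one_sidedC.
Qed.

(** Each of the two alternatives of [one_sided_comparison_antithetic] has
    probability one half. *)
Lemma antithetic_pair A B I :
  (@antithetic_law R n A \x @antithetic_law R n B)%E (concordant I) =
  (((one_sided I A)%:R + (one_sided I B)%:R) / 2)%:E.
Proof.
rewrite concordant_comparison; last exact: antithetic_law_set1.
pose E : set (d.-tuple R * d.-tuple R) := [set p | one_sided I (comparison_set p)].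
have mE : measurable E by exact: (measurable_comparison_set (one_sided I)).
pose S : set (T * T) := (fun p => (antithetic A p.1, antithetic B p.2)) @^-1` E.
have mS : measurable S.
  rewrite -[X in measurable X]setTI.
  have mf : measurable_fun [set: T * T] (fun p : T * T => (antithetic A p.1, antithetic B p.2)).
    by apply: measurable_fun_pair => /=; apply: measurableT_comp => //; exact: measurable_antithetic.
  exact: mf.
(* Transport to the square along the two maps from [v] and [v']. *)
transitivity ((lam \x lam)%E S).
  rewrite /= /product_measure1 ge0_integral_pushforward//.
  exact: measurable_fun_xsection.
have SE := one_sided_comparison_antithetic A B I.
have muS := @eq_measure_off_null _ _ _ (lam \x lam)%E S _ _ mS _ measurable_diagonals diagonals_null.
have [h1 h2] := same_sign_half; have mss := measurable_same_sign.
move: SE; case: (one_sided I A); case: (one_sided I B) => SE.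
- rewrite (muS setT)//; last by move=> p /SE; rewrite /S/= /E/= => ->; case: ifP.
  by apply: etrans (probability_setT _) _; congr _%:E; rewrite /= ?mulr1n ?mulr0n; lra.
- rewrite (muS [set p | same_sign p])//; last first.
    by move=> p /SE; rewrite /S/= /E/= => ->; case: ifP.
  by apply: etrans h1 _; congr _%:E; rewrite /= ?mulr1n ?mulr0n; lra.
- rewrite (muS (~` [set p | same_sign p])); last 2 first.
  + exact: measurableC.
  + by move=> p /SE; rewrite /S/= /E/= => ->; case: (same_sign p); split => // /(_ isT).
  by apply: etrans h2 _; congr _%:E; rewrite /= ?mulr1n ?mulr0n; lra.
- rewrite (muS set0)//; last by move=> p /SE; rewrite /S/= /E/= => ->; case: ifP.
  by rewrite measure0; congr _%:E; rewrite /= ?mulr1n ?mulr0n; lra.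
Qed.

End pair.

(** * Signatures of extremal mixtures *)

(** Summing [antithetic_pair] over all pairs with weights [w k * w l] gives a
    linear expression in [w] because the pair value is an average and the
    weights sum to [1]. *)
Lemma mixture_law (R : realType) n (w : 'I_(2 ^ n.+1.-1) -> R) : is_weight w ->
  exists2 Q : probability (n.+1.-tuple R) R, law_of (mixture w) Q &
    forall I, (Q \x Q)%E (concordant I) = (\sum_k w k * acoef R I k)%:E.
Proof.
move=> [w0 w1].
have [Q [QE Qint]] :=
  convex_combination (fun k => @antithetic_law R n (Jset (k : 'I_(2 ^ n.+1.-1)))) w0 w1.
exists Q => [|I]; first split.
- move=> u; rewrite QE /mixture -sumEFin; apply: eq_bigr => k _.
  by rewrite antithetic_law_box EFinM.
- move=> j A mA; rewrite /pushforward QE.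
  under eq_bigr do rewrite [X in (_ * X)%E](antithetic_law_margin _ _ mA).
  have : uniform_prob (@ltr01 R) A \is a fin_num by exact: fin_num_measure.
  move: (uniform_prob _ A) => [r| |]// _.
  by under eq_bigr do rewrite -EFinM; rewrite sumEFin -mulr_suml w1 mul1r.
rewrite (product_convex_combination w0 QE Qint); last exact: measurable_concordant.
under eq_bigr => k _ do under eq_bigr => l _ do rewrite antithetic_pair -!EFinM.
under eq_bigr => k _ do rewrite sumEFin.
rewrite sumEFin; congr _%:E.
pose a k := acoef R I k.
transitivity (\sum_k \sum_l (w k * a k * (w l / 2) + w k / 2 * (w l * a l))).
  by apply: eq_bigr => k _; apply: eq_bigr => l _; rewrite /a !acoefE; field.
under eq_bigr do rewrite big_split/= -!mulr_sumr -mulr_suml w1.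
by rewrite big_split/= -!mulr_suml w1 /a; field.
Qed.

Lemma mixture_copula (R : realType) n (w : 'I_(2 ^ n.+1.-1) -> R) :
  is_weight w -> is_copula (mixture w).
Proof. by move=> /mixture_law[Q wQ _]; exists Q. Qed.

Lemma even_signature_mixture (R : realType) n (w : 'I_(2 ^ n.+1.-1) -> R) :
  is_weight w -> even_signature (mixture w) = \sum_k w k *: avec R k.
Proof.
move=> ww; have [Q wQ QI] := mixture_law ww.
apply/ffunP => I; rewrite sum_ffunE ffunE.
under eq_bigr do rewrite !ffunE.
have [I1|I1] := ltnP 1 #|val I|.
  by apply: EFin_inj; rewrite -(kappa_law wQ I1) QI.
by apply: kappa_small => //; case: ww.
Qed.

Theorem theorem1 (R : realType) (d : nat) (hd : (2 <= d)%N)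
    (C : cube R d -> R) (hC : is_copula C) :
  (exists! Cstar : cube R d -> R,
     is_extremal_mixture Cstar /\ even_signature C = even_signature Cstar) /\
  (forall w : 'I_(2 ^ d.-1) -> R,
     is_weight w -> even_signature C = even_signature (mixture w) ->
     unique (fun v : 'I_(2 ^ d.-1) -> R =>
       even_signature C = \sum_(k < 2 ^ d.-1) v k *: avec R k) w).
Proof.
case: d hd C hC => // n _ C hC.
have inj (v w : 'I_(2 ^ n) -> R) :
    \sum_(k < 2 ^ n.+1.-1) v k *: avec R k = \sum_(k < 2 ^ n.+1.-1) w k *: avec R k -> v = w.
  move=> vw; apply/funext => k; apply/eqP; rewrite -subr_eq0; apply/eqP.
  move: k; apply: (@avec_free R n (fun k => v k - w k)) => I evenI.
  have /ffunP/(_ (Sub I evenI)) := vw; rewrite !sum_ffunE.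
  under eq_bigr do rewrite !ffunE SubK.
  under [in RHS]eq_bigr do rewrite !ffunE SubK.
  move=> /eqP; rewrite -subr_eq0 -sumrB => /eqP {2}<-.
  by apply: eq_bigr => k _; rewrite mulrBl.
have [w ww Cw] := copula_weights hC.
have sigC : even_signature C = \sum_(k < 2 ^ n.+1.-1) w k *: avec R k.
  apply/ffunP => I; rewrite sum_ffunE ffunE Cw.
  by apply: eq_bigr => k _; rewrite !ffunE.
split.
  exists (mixture w); split.
    split; last by rewrite even_signature_mixture.
    by split; [exact: mixture_copula|exists w].
  move=> _ [[_ [v wv ->]]]; rewrite even_signature_mixture// sigC.
  by move=> /inj ->.
move=> v wv Cv; split; first by rewrite Cv even_signature_mixture.
move=> v' Cv'; apply: inj.
by rewrite -Cv' Cv even_signature_mixture.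
Qed.
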